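(* Let $A,B\in\mathcal{M}_n^+$ be such that $B\le A$. Then, for $j=1,2,\dots,n$, $$s_j(A\sharp B-A!B)\le\frac18\, s_j\!\left((A-B)(A\sharp B)^{-1}(A-B)\right)\le\frac18\, s_j\!\left(B^{-\frac12}(A-B)^2B^{-\frac12}\right).$$
   Context: $\mathcal{M}_n^+$ denotes the set of positive (definite) $n\times n$ complex matrices: $A\in\mathcal{M}_n^+$ iff $\langle Ax,x\rangle>0$ for all nonzero $x\in\mathbb{C}^n$. For Hermitian matrices, $X\le Y$ means that $Y-X$ is positive semidefinite. For $A,B\in\mathcal{M}_n^+$, the geometric mean is $A\sharp B=A^{1/2}\left(A^{-1/2}BA^{-1/2}\right)^{1/2}A^{1/2}$ and the harmonic mean is $A!B=\left(\frac{A^{-1}+B^{-1}}{2}\right)^{-1}$. $s_j(X)$ denotes the $j$-th singular value of the $n\times n$ matrix $X$, the singular values being arranged in decreasing order and counted with multiplicity. *)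

(* Defs.v *)
From mathcomp Require Import all_boot all_order all_algebra.
From mathcomp Require Import sesquilinear spectral.

Set Implicit Arguments.
Unset Strict Implicit.
Unset Printing Implicit Defensive.

Import Order.TTheory GRing.Theory Num.Theory.
Local Open Scope ring_scope.
Local Open Scope sesquilinear_scope.

Section MatrixMeans.
Context {C : numClosedFieldType} {n : nat}.
Implicit Types (A B X Y S : 'M[C]_n) (x : 'cV[C]_n).

(* The inner product <Ax, x> = x^* A x.  In a numClosedFieldType, [0 < z] and
   [0 <= z] include the assertion that z is real. *)
Definition qform A x : C := (x^t* *m A *m x) 0 0.

Definition posdefmx A : Prop := forall x, x != 0 -> 0 < qform A x.

Definition possemidefmx A : Prop := forall x, 0 <= qform A x.

(* Positive semidefinite complex matrices are Hermitian (possemidefmx_herm), so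
   for Hermitian X and Y this is the Loewner order. *)
Definition loewner_le X Y : Prop := possemidefmx (Y - X).

(* The positive square root by functional calculus on the spectral decomposition
   A = P^-1 diag(d) P, P unitary; meaningful for positive semidefinite A, where
   it is the unique positive semidefinite square root (sqrtmx_semidef,
   sqrtmx_sqr, sqrtmx_unique). *)
Definition sqrtmx A : 'M[C]_n :=
  invmx (spectralmx A) *m diag_mx (map_mx sqrtC (spectral_diag A))
    *m spectralmx A.

Definition geometric_mean A B : 'M[C]_n :=
  sqrtmx A *m sqrtmx (invmx (sqrtmx A) *m B *m invmx (sqrtmx A)) *m sqrtmx A.

Definition harmonic_mean A B : 'M[C]_n :=
  invmx (2^-1 *: (invmx A + invmx B)).

(* Square roots of the n eigenvalues of X^* X, i.e. the eigenvalues of |X|,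
   with multiplicity (char_poly_singular_values).  They are nonnegative reals,
   so the partial order of C does sort them (singular_values_sorted). *)
Definition singular_values X : seq C :=
  sort >=%R [seq sqrtC (spectral_diag (X^t* *m X) 0 i) | i : 'I_n].

(* Indices start at 0: [singular_value X j] is s_(j+1)(X). *)
Definition singular_value X (j : 'I_n) : C := nth 0 (singular_values X) j.

Lemma qform_conj A x : qform (A^t*) x = (qform A x)^*.
Proof.
rewrite /qform.
have -> : x^t* *m A^t* *m x = (x^t* *m A *m x)^t*.
  by rewrite !trmx_mul !map_mxM mulmxA trmxCK.
by rewrite !mxE.
Qed.

Lemma posdefmxW A : posdefmx A -> possemidefmx A.
Proof.
move=> pA x; have [->|/pA/ltW//] := eqVneq x 0.
by rewrite /qform mulmx0 mxE.
Qed.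

Lemma possemidefmx_herm A : possemidefmx A -> A \is hermsymmx.
Proof.
move=> pA; apply/is_hermitianmxP; rewrite expr0 scale1r.
have [H eH] : {H | H = A - A^t*} by exists (A - A^t*).
have H0 x : qform H x = 0.
  rewrite eH {1}/qform mulmxBr mulmxBl mxE [(- _ : 'M_1) 0 0]mxE.
  by rewrite -/(qform A x) -/(qform (A^t*) x) qform_conj geC0_conj ?subrr.
apply/eqP; rewrite -subr_eq0 -eH; apply/eqP/matrixP => i j; rewrite [RHS]mxE.
pose e k : 'cV[C]_n := delta_mx k 0.
have Hkl k l : ((e k)^t* *m H *m e l) 0 0 = H k l.
  have -> : (e k)^t* = delta_mx 0 k.
    by apply/matrixP => a b; rewrite !mxE andbC; case: (_ && _);
       rewrite ?rmorph1 ?rmorph0.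
  by rewrite -rowE -colE !mxE.
have Hc c : c * H i j + c^* * H j i = 0.
  have := H0 (e i + c *: e j); rewrite /qform.
  rewrite [(_ + _)^T]linearD /= [(c *: _)^T]linearZ /= map_mxD map_mxZ.
  rewrite !mulmxDl !mulmxDr -?(scalemxAl, scalemxAr).
  have addE (M N : 'M[C]_1) : (M + N) 0 0 = M 0 0 + N 0 0 by rewrite mxE.
  have scaleE a (M : 'M[C]_1) : (a *: M) 0 0 = a * M 0 0 by rewrite mxE.
  rewrite !(addE, scaleE) !Hkl.
  have := H0 (e i); have := H0 (e j); rewrite /qform !Hkl => -> ->.
  by rewrite !mulr0 add0r !addr0.
have := Hc 1; rewrite rmorph1 !mul1r => /eqP; rewrite addr_eq0 => /eqP h1.
have := Hc 'i; rewrite conjCi mulNr -mulrBr => /eqP.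
rewrite mulf_eq0 (negbTE (neq0Ci _)) /= h1 -opprD oppr_eq0 -mulr2n.
by rewrite mulrn_eq0 => /eqP ->; rewrite oppr0.
Qed.

Lemma possemidefmx_spectral A : possemidefmx A ->
  A = invmx (spectralmx A) *m diag_mx (spectral_diag A) *m spectralmx A.
Proof.
by move=> /possemidefmx_herm/hermitian_normalmx/orthomx_spectralP.
Qed.

Lemma possemidefmx_diag A : possemidefmx A ->
  forall i, 0 <= spectral_diag A 0 i.
Proof.
move=> pA i; have := pA ((spectralmx A)^t* *m delta_mx i 0).
set P := spectralmx A; rewrite /qform.
have uP : P \is unitarymx by exact: spectral_unitarymx.
have := possemidefmx_spectral pA; rewrite -/P => eA.
rewrite [X in _ *m X *m _]eA invmx_unitary // trmx_mul map_mxM trmxCK.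
have -> : ((delta_mx i 0 : 'cV[C]_n)^t* : 'rV_n) = delta_mx 0 i.
  by apply/matrixP => a b; rewrite !mxE andbC; case: (_ && _);
     rewrite ?rmorph1 ?rmorph0.
have PP : P *m P^t* = 1%:M by apply/unitarymxP.
rewrite !mulmxA -[delta_mx 0 i *m P *m P^t*]mulmxA PP mulmx1.
rewrite -[_ *m P *m P^t*]mulmxA PP mulmx1 -rowE -colE !mxE eqxx.
by rewrite mulr1n.
Qed.

Lemma sqrtmx_semidef A : possemidefmx A -> possemidefmx (sqrtmx A).
Proof.
move=> pA x; rewrite /qform /sqrtmx invmx_unitary ?spectral_unitarymx //.
set P := spectralmx A; set d := map_mx sqrtC _.
have -> : x^t* *m (P^t* *m diag_mx d *m P) *m x =
  (P *m x)^t* *m diag_mx d *m (P *m x).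
  by rewrite trmx_mul map_mxM !mulmxA.
rewrite mxE sumr_ge0 // => k _; rewrite mul_mx_diag !mxE.
rewrite mulrAC [_^* * _]mulrC; apply: mulr_ge0; first exact: mul_conjC_ge0.
by rewrite sqrtC_ge0 possemidefmx_diag.
Qed.

Lemma sqrtmx_sqr A : possemidefmx A -> sqrtmx A *m sqrtmx A = A.
Proof.
move=> pA; rewrite [RHS]possemidefmx_spectral // /sqrtmx.
set P := spectralmx A; have uP : P \in unitmx by exact: spectral_unit.
rewrite !mulmxA mulmxK // -[_ *m diag_mx _ *m diag_mx _]mulmxA mulmx_diag.
congr (_ *m diag_mx _ *m _); apply/rowP => i.
by rewrite !mxE -expr2 sqrtCK.
Qed.

Lemma sqrtmx_unique A S : possemidefmx A -> possemidefmx S ->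
  S *m S = A -> S = sqrtmx A.
Proof.
move=> pA pS SA; have := sqrtmx_sqr pA; rewrite -[RHS]SA.
have := possemidefmx_spectral pS; rewrite /sqrtmx.
have : forall i, 0 <= spectral_diag S 0 i by exact: possemidefmx_diag.
have : spectralmx S \in unitmx by exact: spectral_unit.
move: (spectralmx S) (spectral_diag S) => Q f uQ f_ge0 ->.
set P := spectralmx A; set d := map_mx sqrtC _.
have uP : P \in unitmx by exact: spectral_unit.
rewrite !mulmxA !mulmxK // => e.
have [W defW] : {W | W = Q *m invmx P} by exists (Q *m invmx P).
have eW : W *m diag_mx d *m diag_mx d = diag_mx f *m diag_mx f *m W.
  have := congr1 (fun M => Q *m M *m invmx P) e.
  by rewrite /= defW !mulmxA !mulmxK // mulmxV // mul1mx.
have eW1 : W *m diag_mx d = diag_mx f *m W.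
  apply/matrixP => i j; have := congr1 (fun M : 'M_n => M i j) eW.
  rewrite -[diag_mx f *m _ *m W]mulmxA !mul_diag_mx !mul_mx_diag !mxE.
  set w := W i j => ew.
  have d0 : 0 <= sqrtC (spectral_diag A 0 j).
    by rewrite sqrtC_ge0 possemidefmx_diag.
  have f0 : 0 <= f 0 i by [].
  have [->|w0] := eqVneq w 0; first by rewrite mul0r mulr0.
  suff -> : f 0 i = sqrtC (spectral_diag A 0 j) by rewrite mulrC.
  apply/eqP; rewrite -(eqrXn2 (n := 2)) // !expr2.
  by apply/eqP; apply: (mulIf w0); rewrite -mulrA -ew -mulrA mulrC.
have := congr1 (fun M => invmx Q *m M *m P) eW1.
by rewrite /= defW !mulmxA mulVmx // mul1mx mulmxKV.
Qed.

Lemma gram_semidef X : possemidefmx (X^t* *m X).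
Proof.
move=> x; rewrite /qform.
have -> : x^t* *m (X^t* *m X) *m x = (X *m x)^t* *m (X *m x).
  by rewrite trmx_mul map_mxM !mulmxA.
by rewrite mxE sumr_ge0 // => k _; rewrite !mxE mulrC mul_conjC_ge0.
Qed.

Lemma size_singular_values X : size (singular_values X) = n.
Proof. by rewrite size_sort size_map -cardE card_ord. Qed.

Lemma singular_values_ge0 X s : s \in singular_values X -> 0 <= s.
Proof.
rewrite mem_sort => /mapP[i _ ->].
by rewrite sqrtC_ge0; apply: possemidefmx_diag; exact: gram_semidef.
Qed.

Lemma singular_values_sorted X : sorted >=%R (singular_values X).
Proof.
apply: (@sort_sorted_in _ (fun s : C => 0 <= s)) => [s t s0 t0|].
  by rewrite orbC real_leVge ?ger0_real.
by apply/allP => s; rewrite -(mem_sort >=%R); exact: singular_values_ge0.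
Qed.

Lemma char_poly_singular_values X :
  char_poly (X^t* *m X) = \prod_(s <- singular_values X) ('X - (s ^+ 2)%:P).
Proof.
set G := X^t* *m X; rewrite (perm_big _ (permEl (perm_sort _ _))) big_map /=.
have eG := possemidefmx_spectral (gram_semidef X); rewrite -/G in eG.
rewrite {1}eG; set P := spectralmx G.
have uP : P \in unitmx by exact: spectral_unit.
have cPV : map_mx polyC (invmx P) *m map_mx polyC P = 1%:M.
  by rewrite -map_mxM mulVmx // map_mx1.
have -> : char_poly (invmx P *m diag_mx (spectral_diag G) *m P) =
          char_poly (diag_mx (spectral_diag G)).
  rewrite /char_poly /char_poly_mx !map_mxM.
  have {1}-> : 'X%:M = map_mx polyC (invmx P) *m 'X%:M *m map_mx polyC P.
    by rewrite scalar_mxC -mulmxA cPV mulmx1.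
  rewrite -mulmxBl -mulmxBr !det_mulmx mulrAC -det_mulmx cPV det1 mul1r //.
rewrite char_poly_trig ?diag_mx_is_trig // big_enum /=; apply: eq_bigr => i _.
by rewrite sqrtCK mxE eqxx mulr1n.
Qed.

End MatrixMeans.

(* Main.v *)
(** The congruence M = P A^(1/2), where the unitary P diagonalizes
    X = A^(-1/2) B A^(-1/2) = P^* diag(t^2) P, gives A = M^* M,
    B = M^* diag(t^2) M and A # B = M^* diag(t) M.  Hence A # B - A ! B,
    (A - B) (A # B)^-1 (A - B) and (A - B) B^-1 (A - B) are M^* diag(f(t)) M for
    f = t - 2 t^2 / (1 + t^2), (1 - t^2)^2 / t and (1 - t^2)^2 / t^2, and scalar
    inequalities between these functions become Loewner inequalities, the second
    because B <= A forces t <= 1.  Singular values are monotone for the Loewner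
    order on positive semidefinite matrices, and B^(-1/2) (A - B)^2 B^(-1/2) has
    the same characteristic polynomial as (A - B) B^-1 (A - B). *)
Require Import Defs.
From mathcomp Require Import all_boot all_order all_algebra.
From mathcomp Require Import reals complex.
From mathcomp Require Import sesquilinear spectral ring.

Set Implicit Arguments.
Unset Strict Implicit.
Unset Printing Implicit Defensive.

Import Order.TTheory GRing.Theory Num.Theory.
Local Open Scope ring_scope.
Local Open Scope sesquilinear_scope.

(** * Characteristic polynomials of products, and kernel vectors *)

Lemma char_poly_mulC (R : idomainType) n (A B : 'M[R]_n) :
  char_poly (A *m B) = char_poly (B *m A).
Proof.
rewrite /char_poly /char_poly_mx !map_mxM /=.
set P := map_mx _ A; set Q := map_mx _ B.
(* Two block triangular multipliers clear [Q], respectively [P], from [K]. Comparing determinants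
   gives the claim up to the factor [\det 'X%:M], which is nonzero and cancels in a domain. *)
pose K : 'M[{poly R}]_(n + n) := block_mx 'X%:M P Q 1%:M.
have K1 : \det K = \det ('X%:M - P *m Q).
  have := det_mulmx K (block_mx 1%:M 0 (- Q) 1%:M).
  rewrite mulmx_block !mulmx1 !mulmx0 !mul1mx !addrN mulmxN !add0r.
  by rewrite det_ublock det_lblock !det1 !mulr1.
have K2 : \det K * \det ('X%:M : 'M[{poly R}]_n)
        = \det ('X%:M : 'M[{poly R}]_n) * \det ('X%:M - Q *m P).
  have := det_mulmx K (block_mx 1%:M (- P) 0 'X%:M).
  rewrite mulmx_block !mulmx1 !mulmx0 !mul1mx !addr0 !mulmxN.
  rewrite -scalar_mxC addNr det_ublock det_lblock !det1 !mul1r => <-.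
  by rewrite addrC.
apply: (mulfI (x := \det ('X%:M : 'M[{poly R}]_n))).
  by rewrite det_scalar expf_neq0 // polyX_eq0.
by rewrite -K2 K1 mulrC.
Qed.

Lemma char_poly_conjV (R : fieldType) n (P A : 'M[R]_n) : P \in unitmx ->
  char_poly (invmx P *m A *m P) = char_poly A.
Proof. by move=> uP; rewrite char_poly_mulC !mulmxA mulmxV ?mul1mx. Qed.

Lemma exists_kernel_vector (F : fieldType) m n (M : 'M[F]_(m, n)) :
  (\rank M < n)%N -> exists2 x : 'cV_n, x != 0 & M *m x = 0.
Proof.
move=> mn; have : kermx M^T != 0.
  by rewrite -mxrank_eq0 mxrank_ker mxrank_tr -lt0n subn_gt0.
case/rowV0Pn => v /sub_kermxP vM v0; exists v^T; first by rewrite trmx_eq0.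
by rewrite -[M]trmxK -trmx_mul vM trmx0.
Qed.

(** * Calculus of diagonal congruences *)

Section DiagCong.
Context {C : numClosedFieldType} {n : nat}.
Implicit Types (A B X Y M P : 'M[C]_n) (x : 'cV[C]_n) (d e : 'rV[C]_n).

(** [M] need not be unitary, so [d] is in general not the spectrum. For a fixed invertible [M],
    however, sums, scalings and the Loewner order are all read off entrywise from [d]. *)
Definition diag_cong M d : 'M[C]_n := M^t* *m diag_mx d *m M.

Lemma qform_diag_cong M d x :
  qform (diag_cong M d) x = \sum_i d 0 i * `|(M *m x) i 0| ^+ 2.
Proof.
rewrite /qform /diag_cong.
have -> : x^t* *m (M^t* *m diag_mx d *m M) *m x =
  (M *m x)^t* *m diag_mx d *m (M *m x).
  by rewrite trmx_mul map_mxM !mulmxA.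
rewrite mxE; apply: eq_bigr => k _; rewrite mul_mx_diag normCK !mxE.
by rewrite mulrAC mulrC; congr (_ * _); rewrite mulrC.
Qed.

Lemma diag_congB M d e : diag_cong M d - diag_cong M e = diag_cong M (d - e).
Proof. by rewrite /diag_cong linearB /= mulmxBr mulmxBl. Qed.

Lemma diag_congD M d e : diag_cong M d + diag_cong M e = diag_cong M (d + e).
Proof. by rewrite /diag_cong linearD /= mulmxDr mulmxDl. Qed.

Lemma diag_congZ M a d : a *: diag_cong M d = diag_cong M (a *: d).
Proof. by rewrite /diag_cong linearZ /= -scalemxAr -scalemxAl. Qed.

Lemma diag_cong_semidef M d : (forall i, 0 <= d 0 i) ->
  possemidefmx (diag_cong M d).
Proof.
move=> d0 x; rewrite qform_diag_cong sumr_ge0 // => i _.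
by rewrite mulr_ge0 // exprn_ge0.
Qed.

Lemma loewner_diag_cong M d e : (forall i, d 0 i <= e 0 i) ->
  loewner_le (diag_cong M d) (diag_cong M e).
Proof.
move=> de; rewrite /loewner_le diag_congB; apply: diag_cong_semidef => i.
by rewrite !mxE subr_ge0.
Qed.

Lemma qform_diag_cong_delta M d i : M \in unitmx ->
  qform (diag_cong M d) (invmx M *m delta_mx i 0) = d 0 i.
Proof.
move=> uM; rewrite qform_diag_cong mulKVmx //.
rewrite (bigD1 i) //= big1 => [|k ki]; last first.
  by rewrite !mxE (negbTE ki) normr0 expr0n mulr0.
by rewrite !mxE !eqxx normr1 expr1n mulr1 addr0.
Qed.

Lemma loewner_diag_cong_entry M d e : M \in unitmx ->
  loewner_le (diag_cong M d) (diag_cong M e) -> forall i, d 0 i <= e 0 i.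
Proof.
move=> uM; rewrite /loewner_le diag_congB => le i.
have := le (invmx M *m delta_mx i 0).
by rewrite qform_diag_cong_delta // !mxE subr_ge0.
Qed.

Lemma diag_cong_inv M d : M \in unitmx -> (forall i, d 0 i != 0) ->
  invmx (diag_cong M d) = diag_cong ((invmx M)^t*) (\row_i (d 0 i)^-1).
Proof.
move=> uM d0; set Z := RHS.
have MM : M *m invmx M = 1%:M by rewrite mulmxV.
have MMt : (invmx M)^t* *m M^t* = 1%:M.
  by rewrite -map_mxM -trmx_mul MM trmx1 map_mx1.
have dd : diag_mx (\row_i (d 0 i)^-1) *m diag_mx d = 1%:M.
  rewrite mulmx_diag -diag_const_mx; congr diag_mx.
  by apply/rowP => i; rewrite !mxE mulVf.
have ZA : Z *m diag_cong M d = 1%:M.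
  rewrite /Z /diag_cong trmxCK !mulmxA.
  rewrite -[_ *m (invmx M)^t* *m _]mulmxA MMt mulmx1.
  by rewrite -[_ *m _ *m diag_mx d]mulmxA dd mulmx1 mulVmx.
have uA : diag_cong M d \in unitmx by case/mulmx1_unit: ZA.
by rewrite -[LHS]mul1mx -ZA mulmxK.
Qed.

(** The middle factor has the shape of an inverse given by [diag_cong_inv], so the copies of [M]
    cancel. This computes products such as [(A - B) *m invmx B *m (A - B)]. *)
Lemma diag_cong_mul3 M d e : M \in unitmx ->
  diag_cong M d *m diag_cong ((invmx M)^t*) e *m diag_cong M d
    = diag_cong M (\row_i (d 0 i ^+ 2 * e 0 i)).
Proof.
move=> uM.
have MM : M *m invmx M = 1%:M by rewrite mulmxV.
have MMt : (invmx M)^t* *m M^t* = 1%:M.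
  by rewrite -map_mxM -trmx_mul MM trmx1 map_mx1.
rewrite /diag_cong trmxCK !mulmxA mulmxK //.
rewrite -[_ *m (invmx M)^t* *m _]mulmxA MMt mulmx1.
rewrite -[_ *m _ *m diag_mx e]mulmxA mulmx_diag.
rewrite -[_ *m _ *m diag_mx d]mulmxA mulmx_diag; congr (_ *m diag_mx _ *m _).
by apply/rowP => i; rewrite !mxE mulrAC expr2.
Qed.

(** * Singular values of positive semidefinite matrices *)

Lemma possemidefmx_conj A : possemidefmx A -> A^t* = A.
Proof.
by move=> /possemidefmx_herm/is_hermitianmxP; rewrite expr0 scale1r => <-.
Qed.

Lemma possemidefmx_diag_cong X : possemidefmx X ->
  X = diag_cong (spectralmx X) (spectral_diag X).
Proof.
move=> pX; rewrite {1}(possemidefmx_spectral pX).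
by rewrite invmx_unitary ?spectral_unitarymx.
Qed.

Lemma qform1_unitary P x : P \is unitarymx ->
  qform 1%:M x = \sum_i `|(P *m x) i 0| ^+ 2.
Proof.
move=> uP; have -> : 1%:M = diag_cong P (const_mx 1).
  rewrite /diag_cong diag_const_mx mulmx1 -invmx_unitary //.
  by rewrite mulVmx ?unitarymx_unit.
by rewrite qform_diag_cong; apply: eq_bigr => i _; rewrite mxE mul1r.
Qed.

Lemma char_poly_semidef X : possemidefmx X ->
  char_poly X = \prod_(i < n) ('X - (spectral_diag X 0 i)%:P).
Proof.
move=> /possemidefmx_spectral {1}->; rewrite char_poly_conjV ?spectral_unit //.
rewrite char_poly_trig ?diag_mx_is_trig //.
by apply: eq_bigr => i _; rewrite mxE eqxx.
Qed.

(** Since [X] is Hermitian, the squares of both lists are the roots of the characteristic polynomial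
    of [X *m X]; [sqrtC] undoes the squaring because all entries are nonnegative. *)
Lemma singular_values_semidef X : possemidefmx X ->
  perm_eq (singular_values X) [seq spectral_diag X 0 i | i : 'I_n].
Proof.
move=> pX; have d0 := possemidefmx_diag pX.
have sqK s : 0 <= s :> C -> sqrtC (s ^+ 2) = s by exact: exprCK.
have e : perm_eq [seq s ^+ 2 | s <- singular_values X]
                 [seq spectral_diag X 0 i ^+ 2 | i : 'I_n].
  apply: prod_XsubC_eq; rewrite 2!big_map -char_poly_singular_values.
  rewrite possemidefmx_conj //.
  have eX := possemidefmx_spectral pX.
  have uX : spectralmx X \in unitmx by exact: spectral_unit.
  rewrite {1 2}eX !mulmxA mulmxK // -[_ *m diag_mx _ *m diag_mx _]mulmxA.
  rewrite mulmx_diag char_poly_conjV // char_poly_trig ?diag_mx_is_trig //.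
  by rewrite big_enum; apply: eq_bigr => i _; rewrite !mxE eqxx expr2.
have := perm_map sqrtC e; rewrite -map_comp.
rewrite [map _ (singular_values X)](_ : _ = singular_values X); last first.
  rewrite -[RHS]map_id; apply/eq_in_map => t /singular_values_ge0.
  exact: sqK.
congr perm_eq; rewrite -[LHS]map_comp; apply: eq_map => i /=.
by rewrite sqK ?d0.
Qed.

Lemma char_poly_semidef_singular_value X Y : possemidefmx X -> possemidefmx Y ->
  char_poly X = char_poly Y -> singular_value X =1 singular_value Y.
Proof.
move=> pX pY e j; rewrite /singular_value.
suff -> : singular_values X = singular_values Y by [].
have eXY : perm_eq (singular_values X) (singular_values Y).
  apply: (perm_trans (singular_values_semidef pX)).
  rewrite perm_sym; apply: (perm_trans (singular_values_semidef pY)).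
  apply: prod_XsubC_eq; rewrite big_map big_enum big_map big_enum.
  by rewrite -!char_poly_semidef.
apply: (sorted_eq_in (leT := >=%R)) => //; try exact: singular_values_sorted.
  by move=> a b c _ _ _ ba cb; apply: le_trans cb ba.
by move=> a b _ _ ab; apply: le_anti; rewrite andbC.
Qed.

(* Weyl's counting argument: were there fewer large eigenvalues of [Y], some
   nonzero [x] would lie both in the span of the eigenvectors of [X] with
   eigenvalue at least [c] and in that of the eigenvectors of [Y] with
   eigenvalue less than [k * c]. *)
Lemma loewner_count_singular_values (k c : C) X Y :
  0 <= k -> 0 <= c -> possemidefmx X -> possemidefmx Y ->
  loewner_le (k *: X) Y ->
  (count (>= c) (singular_values X)
     <= count (>= (k * c)%R) (singular_values Y))%N.
Proof.
move=> k0 c0 pX pY le.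
pose S := [set i | c <= spectral_diag X 0 i].
pose T := [set i | k * c <= spectral_diag Y 0 i].
have countE (p : pred C) (d : 'rV[C]_n) :
    count p [seq d 0 i | i : 'I_n] = #|[set i | p (d 0 i)]|.
  by rewrite -sum1_count big_map big_enum_cond -sum1dep_card.
rewrite (permP (singular_values_semidef pX)).
rewrite (permP (singular_values_semidef pY)) !countE -/S -/T leqNgt; apply/negP => ST.
set P := spectralmx X; set Q := spectralmx Y.
(* The rows of [P] outside [S] and those of [Q] in [T] number n - |S| + |T| < n, so some nonzero
   vector is killed by all of them. *)
have [] := @exists_kernel_vector _ _ _ (col_mx
  (rowsub (enum_val (A := ~: S)) P) (rowsub (enum_val (A := T)) Q)).
  apply: leq_ltn_trans (rank_leq_row _) _.
  by rewrite -[X in (_ < X)%N](card_ord n) -(cardsC S) addnC ltn_add2r.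
move=> x x0; rewrite mul_col_mx -[0]col_mx0 => /eq_col_mx[xS xT].
have PxS i : i \notin S -> (P *m x) i 0 = 0.
  rewrite -in_setC => iS; have /colP/(_ (enum_rank_in iS i)) := xS.
  by rewrite mul_rowsub_mx !mxE enum_rankK_in.
have QxT i : i \in T -> (Q *m x) i 0 = 0.
  move=> iT; have /colP/(_ (enum_rank_in iT i)) := xT.
  by rewrite mul_rowsub_mx !mxE enum_rankK_in.
have uQ : Q \is unitarymx by exact: spectral_unitarymx.
have cX : c * qform 1%:M x <= qform X x.
  rewrite (qform1_unitary x (spectral_unitarymx X)).
  rewrite [in leRHS](possemidefmx_diag_cong pX).
  rewrite qform_diag_cong mulr_sumr; apply: ler_sum => i _.
  have [|/PxS->] := boolP (i \in S); last by rewrite normr0 expr0n !mulr0.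
  by rewrite inE => ?; rewrite ler_wpM2r ?exprn_ge0.
(* The sum is k c |x|^2 - <Yx, x>, and k c |x|^2 <= k <Xx, x> <= <Yx, x>. Its terms are also
   nonnegative, so all vanish, which forces [Q *m x = 0]. *)
have dY : \sum_i (k * c - spectral_diag Y 0 i) * `|(Q *m x) i 0| ^+ 2 <= 0.
  under eq_bigr do rewrite mulrBl.
  rewrite sumrB -mulr_sumr -qform1_unitary // -qform_diag_cong.
  rewrite -possemidefmx_diag_cong // subr_le0 -mulrA.
  apply: le_trans (ler_wpM2l k0 cX) _.
  have := le x; rewrite /qform mulmxBr mulmxBl mxE -scalemxAr -scalemxAl.
  by rewrite [(- _ : 'M_1) 0 0]mxE [(_ *: _ : 'M_1) 0 0]mxE subr_ge0.
have eY0 i : i \notin T -> 0 < k * c - spectral_diag Y 0 i.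
  rewrite inE => iT; rewrite subr_gt0 real_ltNge // ger0_real ?mulr_ge0 //.
  exact: possemidefmx_diag.
have tY i : 0 <= (k * c - spectral_diag Y 0 i) * `|(Q *m x) i 0| ^+ 2.
  have [/QxT->|/eY0/ltW ?] := boolP (i \in T).
    by rewrite normr0 expr0n mulr0.
  by rewrite mulr_ge0 ?exprn_ge0.
have Qx0 : Q *m x = 0.
  apply/colP => i; rewrite [RHS]mxE.
  have [/QxT//|/eY0 iT] := boolP (i \in T).
  have s0 : \sum_i (k * c - spectral_diag Y 0 i) * `|(Q *m x) i 0| ^+ 2 = 0.
    by apply/eqP; rewrite eq_le dY sumr_ge0.
  have /eqP := psumr_eq0P (fun i (_ : true) => tY i) s0 isT (i := i).
  by rewrite mulf_eq0 (gt_eqF iT) expf_eq0 normr_eq0 => /eqP.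
have := mulKmx (unitarymx_unit uQ) x; rewrite Qx0 mulmx0 => /esym/eqP.
exact/negP.
Qed.

(** Apply the counting lemma with [c] the singular value of [X] at [j]: at least [j.+1] singular
    values of [Y] reach [k * c]. The factor [k] will be 8 for the first inequality and 1 for the
    second. *)
Lemma loewner_singular_value (k : C) X Y (j : 'I_n) :
  0 <= k -> possemidefmx X -> possemidefmx Y -> loewner_le (k *: X) Y ->
  k * singular_value X j <= singular_value Y j.
Proof.
move=> k0 pX pY le; rewrite /singular_value.
set s := singular_values X; set t := singular_values Y.
have zs : size s = n by exact: size_singular_values.
have s0 : 0 <= s`_j.
  by apply: (singular_values_ge0 (X := X)); rewrite mem_nth ?zs.
have cs : (j < count (>= (s`_j)%R) s)%N.
  have ms := sorted_leq_nth (rev_trans le_trans) (@lexx _ C) 0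
    (singular_values_sorted X).
  rewrite -[X in count _ X](cat_take_drop j.+1 s) count_cat.
  rewrite -[X in (X <= _)%N]addn0 leq_add //.
  suff : all (>= s`_j) (take j.+1 s).
    by rewrite all_count size_takel ?zs // => /eqP ->.
  apply/(all_nthP 0) => i; rewrite size_takel ?zs // ltnS => ij.
  by rewrite nth_take //= ms ?inE ?zs // (leq_ltn_trans ij).
(* In the dual order [C^d] the decreasing list [t] becomes increasing. *)
apply: (@Order.PreorderTheory.nth_count_le _ C^d (k * s`_j) 0 t j).
  exact: singular_values_sorted.
exact: leq_trans cs (loewner_count_singular_values _ _ _ _ _).
Qed.

(** * Positive definite matrices and their means as diagonal congruences *)

Lemma posdefmx_unit A : posdefmx A -> A \in unitmx.
Proof.
move=> pA; rewrite -row_free_unit -row_leq_rank leqNgt; apply/negP.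
case/exists_kernel_vector => x /pA; rewrite /qform -mulmxA => + Ax.
by rewrite Ax mulmx0 mxE ltxx.
Qed.

Lemma invmx_conj A : (invmx A)^t* = invmx (A^t*).
Proof. by rewrite trmx_inv map_invmx. Qed.

Lemma sqrtmx_unit A : posdefmx A -> sqrtmx A \in unitmx.
Proof.
move=> pA; have := posdefmx_unit pA.
by rewrite -{1}(sqrtmx_sqr (posdefmxW pA)) unitmx_mul => /andP[].
Qed.

Lemma posdefmx_congr M A : M \in unitmx -> posdefmx A ->
  posdefmx (M^t* *m A *m M).
Proof.
move=> uM pA x x0; have -> : qform (M^t* *m A *m M) x = qform A (M *m x).
  by rewrite /qform trmx_mul map_mxM !mulmxA.
by apply: pA; apply: contraNneq x0 => Mx; rewrite -[x](mulKmx uM) Mx mulmx0.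
Qed.

Lemma posdefmx_diag A i : posdefmx A -> 0 < spectral_diag A 0 i.
Proof.
move=> pA; have uP := spectral_unit A.
rewrite -(qform_diag_cong_delta _ _ uP) -possemidefmx_diag_cong; last first.
  exact: posdefmxW.
apply: pA; apply/eqP => /(congr1 (mulmx (spectralmx A))).
rewrite mulKVmx // mulmx0 => /colP/(_ i)/eqP.
by rewrite !mxE !eqxx oner_eq0.
Qed.

Lemma geometric_mean_diag_cong A B : posdefmx A -> posdefmx B ->
  exists M (t : 'rV[C]_n), [/\ M \in unitmx, forall i, 0 < t 0 i,
    A = diag_cong M (const_mx 1), B = diag_cong M (\row_i t 0 i ^+ 2)
    & geometric_mean A B = diag_cong M t].
Proof.
move=> pA pB; set S := sqrtmx A.
have uS : S \in unitmx := sqrtmx_unit pA.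
have hS : S^t* = S by apply/possemidefmx_conj/sqrtmx_semidef/posdefmxW.
pose X := invmx S *m B *m invmx S.
have pX : posdefmx X.
  have := posdefmx_congr (M := invmx S) _ pB.
  by rewrite unitmx_inv invmx_conj hS; apply.
set P := spectralmx X; have uP : P \in unitmx by exact: spectral_unit.
have hP : P^t* = invmx P by rewrite invmx_unitary ?spectral_unitarymx.
exists (P *m S), (map_mx sqrtC (spectral_diag X)).
have congE d : diag_cong (P *m S) d = S *m (invmx P *m diag_mx d *m P) *m S.
  by rewrite /diag_cong trmx_mul map_mxM hP hS !mulmxA.
split; rewrite ?congE //.
- by rewrite unitmx_mul uP.
- by move=> i; rewrite mxE sqrtC_gt0 posdefmx_diag.
- rewrite diag_const_mx mulmx1 mulVmx // mulmx1.
  by rewrite sqrtmx_sqr //; apply: posdefmxW.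
- have -> : \row_i map_mx sqrtC (spectral_diag X) 0 i ^+ 2 = spectral_diag X.
    by apply/rowP => i; rewrite !mxE sqrtCK.
  rewrite -possemidefmx_spectral; last exact: posdefmxW.
  rewrite /X; move: (S) uS => S' uS'.
  by rewrite !mulmxA mulmxV // mul1mx mulmxKV.
Qed.

(** The inner inverses pass from [M] to [(invmx M)^t*] and the outer inverse passes back to [M]. *)
Lemma harmonic_mean_diag_cong M d e : M \in unitmx ->
  (forall i, 0 < d 0 i) -> (forall i, 0 < e 0 i) ->
  harmonic_mean (diag_cong M d) (diag_cong M e)
    = diag_cong M (\row_i (2^-1 * ((d 0 i)^-1 + (e 0 i)^-1))^-1).
Proof.
move=> uM d0 e0; have d_neq0 i : d 0 i != 0 by rewrite gt_eqF.
have e_neq0 i : e 0 i != 0 by rewrite gt_eqF.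
have uMt : (invmx M)^t* \in unitmx.
  by rewrite map_unitmx unitmx_tr unitmx_inv.
rewrite /harmonic_mean !diag_cong_inv // diag_congD diag_congZ.
rewrite diag_cong_inv // => [|i]; last first.
  rewrite !mxE mulf_neq0 ?invr_eq0 ?pnatr_eq0 //.
  by rewrite gt_eqF // addr_gt0 ?invr_gt0.
rewrite invmx_conj trmxCK invmxK.
by congr diag_cong; apply/rowP => i; rewrite !mxE.
Qed.

(** With [T = X *m invmx (sqrtmx B)] the two matrices are T^* T and T T^*, positive semidefinite
    with equal characteristic polynomials. *)
Lemma singular_value_conj_sqrtmx B X (j : 'I_n) : posdefmx B -> X^t* = X ->
  singular_value (invmx (sqrtmx B) *m (X *m X) *m invmx (sqrtmx B)) j
    = singular_value (X *m invmx B *m X) j.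
Proof.
move=> pB hX; set S := sqrtmx B.
have uS : S \in unitmx := sqrtmx_unit pB.
have hS : (invmx S)^t* = invmx S.
  by rewrite invmx_conj possemidefmx_conj //; apply/sqrtmx_semidef/posdefmxW.
have SSB : invmx S *m invmx S = invmx B.
  have SB : invmx S *m invmx S *m B = 1%:M.
    by rewrite -(sqrtmx_sqr (posdefmxW pB)) -/S mulmxA mulmxKV ?mulVmx.
  by rewrite -[LHS]mulmx1 -(mulmxV (posdefmx_unit pB)) mulmxA SB mul1mx.
have e1 : invmx S *m (X *m X) *m invmx S = (X *m invmx S)^t* *m (X *m invmx S).
  by rewrite trmx_mul map_mxM hS hX !mulmxA.
have e2 : X *m invmx B *m X = (invmx S *m X)^t* *m (invmx S *m X).
  by rewrite trmx_mul map_mxM hS hX -SSB !mulmxA.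
apply: char_poly_semidef_singular_value.
- by rewrite e1; apply: gram_semidef.
- by rewrite e2; apply: gram_semidef.
- by rewrite mulmxA -mulmxA char_poly_mulC -SSB !mulmxA.
Qed.

(** * Scalar inequalities and the conclusion *)

Lemma geometric_harmonic_gap_ge0 (t : C) : 0 < t ->
  0 <= t - (2^-1 * (1^-1 + (t ^+ 2)^-1))^-1.
Proof.
move=> t0; have tn0 : t != 0 by rewrite gt_eqF.
have q0 : 0 < t ^+ 2 + 1 by rewrite addr_gt0 ?exprn_gt0.
have -> : t - (2^-1 * (1^-1 + (t ^+ 2)^-1))^-1
    = t * (1 - t) ^+ 2 / (t ^+ 2 + 1).
  by field; rewrite tn0 (gt_eqF q0).
rewrite divr_ge0 ?(ltW q0) // mulr_ge0 ?(ltW t0) //.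
by rewrite real_exprn_even_ge0 // rpredB // ger0_real // ltW.
Qed.

(** Over the common denominator, the difference of the two sides carries the factor (1 - t)^4, and
    its cofactor has positive coefficients. *)
Lemma geometric_harmonic_gap_le (t : C) : 0 < t ->
  8 * (t - (2^-1 * (1^-1 + (t ^+ 2)^-1))^-1) <= (1 - t ^+ 2) ^+ 2 * t^-1.
Proof.
move=> t0; have tn0 : t != 0 by rewrite gt_eqF.
have q0 : 0 < t ^+ 2 + 1 by rewrite addr_gt0 ?exprn_gt0.
rewrite -subr_ge0.
have -> : (1 - t ^+ 2) ^+ 2 * t^-1 - 8 * (t - (2^-1 * (1^-1 + (t ^+ 2)^-1))^-1)
    = (1 - t) ^+ 4 * (1 + 4 * t + t ^+ 2) / (t * (t ^+ 2 + 1)).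
  by field; rewrite tn0 (gt_eqF q0).
apply: divr_ge0; last by rewrite mulr_ge0 ?ltW.
apply: mulr_ge0.
  by rewrite real_exprn_even_ge0 // rpredB // ger0_real // ltW.
by rewrite !addr_ge0 ?mulr_ge0 ?exprn_ge0 // ltW.
Qed.

Lemma geometric_harmonic_gap_singular_value A B (j : 'I_n) :
  posdefmx A -> posdefmx B -> loewner_le B A ->
  singular_value (geometric_mean A B - harmonic_mean A B) j
    <= 8^-1 * singular_value
         ((A - B) *m invmx (geometric_mean A B) *m (A - B)) j
    <= 8^-1 * singular_value
         (invmx (sqrtmx B) *m ((A - B) *m (A - B)) *m invmx (sqrtmx B)) j.
Proof.
move=> hA hB hBA.
rewrite singular_value_conj_sqrtmx ?possemidefmx_conj //.
have [M [t [uM t0 eA eB eG]]] := geometric_mean_diag_cong hA hB.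
have t2_gt0 i : 0 < (\row_i t 0 i ^+ 2) 0 i by rewrite mxE exprn_gt0.
(* Here [A] has diagonal 1 and [B] has diagonal t^2, so [loewner_le B A] reads t^2 <= 1. *)
have t_le1 i : t 0 i <= 1.
  have := hBA; rewrite eA eB => /(loewner_diag_cong_entry uM)/(_ i).
  by rewrite !mxE expr_le1 // ltW.
rewrite eG eA eB harmonic_mean_diag_cong // => [|i]; last by rewrite mxE.
rewrite !diag_congB !diag_cong_inv // => [|i|i]; last 2 first.
- by rewrite gt_eqF.
- by rewrite gt_eqF.
have t_ge0 i : 0 <= t 0 i by rewrite ltW.
have sq_ge0 i : 0 <= (1 - t 0 i ^+ 2) ^+ 2.
  by rewrite exprn_ge0 // subr_ge0 expr_le1.
rewrite !diag_cong_mul3 //; set Q := (X in _ <= 8^-1 * singular_value X _).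
have Q_ge0 : possemidefmx Q.
  by apply: diag_cong_semidef => i; rewrite !mxE divr_ge0.
apply/andP; split.
  rewrite -ler_pdivrMl ?invr_gt0 ?ltr0n // invrK.
  apply: loewner_singular_value => //.
    apply: diag_cong_semidef => i; rewrite !mxE.
    exact: geometric_harmonic_gap_ge0.
  rewrite diag_congZ; apply: loewner_diag_cong => i; rewrite !mxE.
  exact: geometric_harmonic_gap_le.
rewrite ler_wpM2l ?invr_ge0 // -[leLHS]mul1r.
apply: loewner_singular_value => //.
  apply: diag_cong_semidef => i; rewrite !mxE.
  by rewrite divr_ge0 // exprn_ge0.
rewrite scale1r; apply: loewner_diag_cong => i; rewrite !mxE.
(* What remains is 1/t <= 1/t^2, that is t^2 <= t, which follows from t <= 1. *)
rewrite ler_wpM2l // lef_pV2 ?posrE ?exprn_gt0 // expr2.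
by rewrite -[leRHS]mul1r ler_wpM2r.
Qed.

End DiagCong.

Theorem corollary2p7 (R : realType) (n : nat) (A B : 'M[R[i]]_n)
    (hA : posdefmx A) (hB : posdefmx B) (hBA : loewner_le B A) (j : 'I_n) :
  singular_value (geometric_mean A B - harmonic_mean A B) j
    <= 8^-1 * singular_value
         ((A - B) *m invmx (geometric_mean A B) *m (A - B)) j
    <= 8^-1 * singular_value
         (invmx (sqrtmx B) *m ((A - B) *m (A - B)) *m invmx (sqrtmx B)) j.
Proof. exact: geometric_harmonic_gap_singular_value. Qed.
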